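(* Let $X$ be an infinite-dimensional Polish topological vector space and let $T\in\mathfrak L(X)$. If $T$ satisfies the Frequent Hypercyclicity Criterion, then $T$ is hereditarily frequently hypercyclic.
   Context: $\mathfrak L(X)$ denotes the space of continuous linear operators on $X$. For $x\in X$ and $V\subset X$, $\mathcal N_T(x,V):=\{n\in\mathbb N: T^nx\in V\}$. The lower density of $A\subset\mathbb N$ is $\liminf_{N\to\infty}\frac{\#(A\cap[1,N])}{N}$. An operator $T$ satisfies the Frequent Hypercyclicity Criterion if there exist a dense set $\mathcal D\subset X$ and a map $S:\mathcal D\to\mathcal D$ such that $TSx=x$ for all $x\in\mathcal D$, and for every $x\in\mathcal D$ the series $\sum_n T^nx$ and $\sum_n S^nx$ are unconditionally convergent. $T$ is hereditarily frequently hypercyclic if for every countable family $(V_i)_{i\in I}$ of non-empty open subsets of $X$ and every family $(A_i)_{i\in I}$ of subsets of $\mathbb N$ with positive lower density (indexed by the same countable set $I$), there exists $x\in X$ such that $\mathcal N_T(x,V_i)\cap A_i$ has positive lower density for every $i\in I$. *)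

(* Defs.v *)
From HB Require Import structures.
From mathcomp Require Import all_boot all_order all_algebra.
From mathcomp Require Import all_classical all_reals all_analysis.
From mathcomp Require Import complex.
Set Implicit Arguments. Unset Strict Implicit. Unset Printing Implicit Defensive.
Import Order.TTheory GRing.Theory Num.Theory.
Import numFieldTopology.Exports.
Local Open Scope classical_set_scope.
Local Open Scope ring_scope.

Definition polish (R : realType) (X : topologicalType) : Prop :=
  (exists D : set X, countable D /\ dense D) /\
  (exists d : X -> X -> R,
     [/\ (forall x y, d x y = 0 <-> x = y),
         (forall x y, d x y = d y x),
         (forall x y z, d x z <= d x y + d y z),
         (forall A : set X,
            open A <-> (forall x, A x -> exists2 e : R, 0 < e &
                          [set y | d x y < e] `<=` A)) &
         (forall u : nat -> X,
            (forall e : R, 0 < e -> exists N : nat,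
                forall m n, (N <= m)%N -> (N <= n)%N -> d (u m) (u n) < e) ->
            exists l : X, u @ \oo --> l)]).

Definition infinite_dimensional (K : numDomainType) (X : lmodType K) : Prop :=
  forall s : seq X, exists x : X,
    ~ (exists c : 'I_(size s) -> K, x = \sum_(i < size s) c i *: s`_i).

Definition uncond_cvg (K : numDomainType) (X : topologicalLmodType K)
  (u : nat -> X) : Prop :=
  forall sigma : nat -> nat, bijective sigma ->
    exists l : X, series (fun n => u (sigma n)) @ \oo --> l.

Definition FHC (K : numDomainType) (X : topologicalLmodType K)
  (T : X -> X) : Prop :=
  exists D : set X, dense D /\
  exists S : X -> X,
    [/\ (forall x, D x -> D (S x)),
        (forall x, D x -> T (S x) = x) &
        (forall x, D x ->
           uncond_cvg (fun n => iter n T x) /\ uncond_cvg (fun n => iter n S x))].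

Definition return_set (X : Type) (T : X -> X) (x : X) (V : set X) : set nat :=
  [set n | V (iter n T x)].

Definition lower_density (R : realType) (A : set nat) : \bar R :=
  limn_einf (fun N : nat =>
    ((\sum_(1 <= n < N.+1) ((n \in A : bool)%:R : R)) / N%:R)%:E).

Definition pos_lower_density (R : realType) (A : set nat) : Prop :=
  (0 < lower_density R A)%E.

Definition HFHC (R : realType) (K : numDomainType) (X : topologicalLmodType K)
  (T : X -> X) : Prop :=
  forall (I : Type) (V : I -> set X) (A : I -> set nat),
    countable [set: I] ->
    (forall i, open (V i) /\ V i !=set0) ->
    (forall i, pos_lower_density R (A i)) ->
    exists x : X, forall i,
      pos_lower_density R (return_set T x (V i) `&` A i).

Definition FHC_implies_HFHC (R : realType) (K : numDomainType) : Prop :=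
  forall (X : topologicalLmodType K) (T : {linear X -> X}),
    polish R X -> infinite_dimensional X -> continuous T ->
    FHC T -> HFHC R T.

(* Main.v *)
(* Fix [x_ i] in [D] and in the [i]-th open set, and look for
   [x = \sum_i \sum_(n in B i) S^n (x_ i)] with [B i] a subset of [A i] of positive
   lower density.  For [m] in [B i], [T^m x - x_ i] is a sum of terms
   [T^(m - n) (x_ j)] and [S^(n - m) (x_ j)] with [n != m] in [B j]; by
   unconditional convergence it is small as soon as the [B j] are separated by
   gaps that are large compared with the indices involved.  Such [B j] are
   obtained by extracting greedily from [A j] a set with very large gaps, and then
   removing from it the points close to the greedy sets of larger index, which are
   so sparse that a positive lower density survives.  The defining series is Cauchy
   for the group structure, and converges by Klee's theorem on completeness. *)
Require Import Defs.
From HB Require Import structures.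
From mathcomp Require Import all_boot all_order all_algebra.
From mathcomp Require Import all_classical all_reals all_analysis.
From mathcomp Require Import complex zify lra.
Set Implicit Arguments. Unset Strict Implicit. Unset Printing Implicit Defensive.
Import Order.TTheory GRing.Theory Num.Theory.
Import numFieldTopology.Exports.

(** * Separated subsets of sets of positive lower density *)

Definition cnt (A : pred nat) (N : nat) : nat := \sum_(0 <= n < N) A n.

Lemma cntS A N : cnt A N.+1 = cnt A N + A N.
Proof. by rewrite /cnt big_nat_recr. Qed.

Lemma cnt0 A : cnt A 0 = 0.
Proof. by rewrite /cnt big_geq. Qed.

Lemma leq_cnt A M N : M <= N -> cnt A M <= cnt A N.
Proof.
move=> /subnKC <-; elim: (N - M) => [|k IH]; first by rewrite addn0.
by rewrite addnS cntS (leq_trans IH) ?leq_addr.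
Qed.

(** Positive lower density expressed in natural numbers, without limits or division: [1 / K] is the
    density bound and [c] absorbs an initial segment. *)
Definition has_pos_density (A : pred nat) : Prop :=
  exists K c, forall N, N <= K * cnt A N + c.

(* [cooldown] counts how long the greedy choice of a subset of [A] with gaps at
   least [M] still has to wait before it may take another element. *)
Fixpoint cooldown (A : pred nat) (M n : nat) : nat :=
  if n is n'.+1 then
    let r := cooldown A M n' in
    if r == 0 then (if A n' then M.-1 else 0) else r.-1
  else M.

Definition greedy (A : pred nat) (M : nat) : pred nat :=
  fun n => A n && (cooldown A M n == 0).

Section Greedy.
Variables (A : pred nat) (M : nat).
Hypothesis M_gt0 : 0 < M.

(** Each chosen element pays [M], for itself and the wait it causes; the cooldown is the part not
    yet spent. The last [M] pays for the initial wait. *)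
Lemma greedy_density N : cnt A N + cooldown A M N <= M * cnt (greedy A M) N + M.
Proof.
elim: N => [|N IH]; first by rewrite !cnt0 /=; lia.
rewrite !cntS /= {2}/greedy; move: IH.
by case: (cooldown A M N) => [|r] /=; case: (A N) => /=; lia.
Qed.

(** The initial wait of [M] precedes the first choice, so no additive constant appears. *)
Lemma greedy_sparse N : M * cnt (greedy A M) N <= N.
Proof.
suff: M * cnt (greedy A M) N + M <= N + cooldown A M N /\ cooldown A M N <= M.
  lia.
elim: N => [|N [IH IHM]]; first by rewrite !cnt0 /=; lia.
rewrite !cntS /= {2}/greedy; move: IH IHM.
by case: (cooldown A M N) => [|r] /=; case: (A N) => /=; lia.
Qed.

Lemma cooldownD n k : cooldown A M n <= cooldown A M (n + k) + k.
Proof.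
elim: k => [|k IH]; first by rewrite !addn0.
rewrite !addnS /=; apply: leq_trans IH _.
by case: (cooldown A M (n + k)) => [|r] /=; case: (A (n + k)) => /=; lia.
Qed.

Lemma greedy_ge n : greedy A M n -> M <= n.
Proof. by case/andP=> _ /eqP r0; have := @cooldownD 0 n; rewrite add0n r0. Qed.

Lemma greedy_gap m n : greedy A M m -> greedy A M n -> m < n -> m + M <= n.
Proof.
case/andP=> Am /eqP rm /andP[An /eqP rn] lt_mn.
have := @cooldownD m.+1 (n - m.+1); rewrite subnKC//= rm Am rn /=; lia.
Qed.

End Greedy.

Lemma cnt_shift_le (A : pred nat) k N : \sum_(0 <= n < N) A (n + k) <= cnt A (N + k).
Proof.
elim: N => [|N IH]; first by rewrite big_geq.
by rewrite big_nat_recr//= addSn cntS leq_add2r.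
Qed.

Lemma cnt_unshift_le (A : pred nat) k N : \sum_(0 <= n < N) ((k <= n) && A (n - k)) <= cnt A N.
Proof.
suff -> : \sum_(0 <= n < N) ((k <= n) && A (n - k)) = cnt A (N - k).
  by rewrite leq_cnt// leq_subr.
elim: N => [|N IH]; first by rewrite big_geq// cnt0.
rewrite big_nat_recr//= IH; case: leqP => [kN|Nk].
  by rewrite subSn// cntS.
by rewrite (_ : N.+1 - k = N - k) ?addn0//; lia.
Qed.

(** The guard [k <= n] keeps truncated subtraction from reading [n - k] as 0. *)
Definition close_to (B : pred nat) (L : nat) : pred nat :=
  fun n => has (fun k => B (n + k) || ((k <= n) && B (n - k))) (iota 0 L).

Lemma close_toPn (B : pred nat) L n m :
  ~~ close_to B L n -> B m -> n + L <= m \/ m + L <= n.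
Proof.
move=> /hasPn hB Bm.
case: (leqP (n + L) m) => [|lt1]; [by left | right].
rewrite leqNgt; apply/negP => lt2.
case: (leqP n m) => [nm|/ltnW mn].
  have := hB (m - n); rewrite mem_iota subnKC// Bm /= => H.
  by have: false by apply: H; lia.
have := hB (n - m); rewrite mem_iota subKn// Bm leq_subr orbT /= => H.
by have: false by apply: H; lia.
Qed.

Lemma has_leq_sum (T : Type) (a : pred T) (s : seq T) :
  (has a s <= \sum_(x <- s) a x)%N.
Proof.
elim: s => [|x s IH]; first by rewrite big_nil.
by rewrite big_cons /=; case: (a x) => //=; apply: leq_trans IH _; rewrite leq_addl.
Qed.

Lemma cnt_close_to (B : pred nat) L N :
  cnt (close_to B L) N <= 2 * L * cnt B (N + L).
Proof.
apply: (@leq_trans (\sum_(0 <= n < N) \sum_(k <- iota 0 L)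
    (B (n + k) + ((k <= n) && B (n - k))))).
  apply: leq_sum => n _; apply: leq_trans (has_leq_sum _ _) _.
  by apply: leq_sum => k _; case: (B (n + k)) => //=; rewrite leq_addr.
rewrite exchange_big /=.
apply: (@leq_trans (\sum_(k <- iota 0 L) 2 * cnt B (N + L))).
  rewrite big_seq [leqRHS]big_seq; apply: leq_sum => k; rewrite mem_iota => /andP[_ kL].
  rewrite big_split /= mul2n -addnn leq_add//.
    by apply: leq_trans (cnt_shift_le _ _ _) (leq_cnt _ _); lia.
  by apply: leq_trans (cnt_unshift_le _ _ _) (leq_cnt _ _); lia.
by rewrite big_const_seq count_predT size_iota iter_addn_0; lia.
Qed.

Lemma sum_le_geometric (a : nat -> nat) (N i J : nat) :
  (forall j, i < j -> a j * 2 ^ j <= N) -> \sum_(i.+1 <= j < J) a j <= N.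
Proof.
move=> ha; case: J => [|J]; first by rewrite big_geq.
(* Subtraction-free form of the inductive bound [N * (1 - 2 ^- J)] on the sum. *)
suff : (\sum_(i.+1 <= j < J.+1) a j) * 2 ^ J.+1 + 2 * N <= N * 2 ^ J.+1.
  by have := expn_gt0 2 J.+1; nia.
elim: J => [|J IH]; first by rewrite big_geq//; lia.
have p := expn_gt0 2 J.
case: (leqP i.+1 J.+1) => iJ; last by rewrite big_geq// !expnS; nia.
by rewrite big_nat_recr//=; have := ha J.+1 iJ; move: IH; rewrite !expnS; nia.
Qed.


(** * Trimming the greedy sets against each other *)

Section SeparatedSubsets.
Variables (A : nat -> pred nat) (L : nat -> nat) (K c : nat -> nat).
Hypothesis L_gt0 : forall i, 0 < L i.
Hypothesis A_density : forall i N, N <= K i * cnt (A i) N + c i.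

(* With [s] at least [K i * gap i] for all [i < j], the first term makes the set
   of points close to [G j] have relative density at most
   [2 ^- j / (2 * K i * gap i)]; the other terms keep [G j] away from [0, j]. *)
Let gap_of j s := 8 * L j * 2 ^ j * s + j + 2 * L j.

(** Carrying the sum of [K i * gap i] over [i < j] lets each gap depend on all earlier ones by
    structural recursion. *)
Fixpoint gap_sum (j : nat) : nat :=
  if j is i.+1 then gap_sum i + K i * gap_of i (gap_sum i) else 0.

Let gap j := gap_of j (gap_sum j).

Let G i := greedy (A i) (gap i).

Let gap_gt0 i : 0 < gap i.
Proof. by rewrite /gap /gap_of; have := L_gt0 i; lia. Qed.

Let gap_sum_le i j : i < j -> K i * gap i <= gap_sum j.
Proof.
elim: j => // j IH; rewrite ltnS leq_eqVlt => /predU1P[->|/IH le_ij] /=.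
  by rewrite leq_addl.
by rewrite (leq_trans le_ij)// leq_addr.
Qed.

(** Testing [j] up to [i + n] suffices: for larger [j], the elements of [G j] are at least
    [j + 2 * L j], hence far from [n]. Testing against the untrimmed [G j] avoids a recursion
    between the trimmed sets. *)
Definition separated_subset (i : nat) : pred nat :=
  fun n => G i n && all (fun j => ~~ close_to (G j) (L j) n) (iota i.+1 n).

Lemma separated_subset_sub i n : separated_subset i n -> A i n /\ L i <= n.
Proof.
case/andP=> Gin _; split; first by case/andP: Gin.
by have := greedy_ge (gap_gt0 _) Gin; rewrite /gap /gap_of; lia.
Qed.

Lemma separated_subset_gap i j m n : i <= j ->
  separated_subset i m -> separated_subset j n ->
  [\/ i = j /\ m = n, m + L j <= n | n + L j <= m].
Proof.
move=> ij /andP[Gim /allP Cim] /andP[Gjn _].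
have gapj : j + 2 * L j <= gap j by rewrite /gap /gap_of; lia.
have [lt_ij|ge_ij] := ltnP i j.
  have [jm|mj] := ltnP j (i.+1 + m).
    have /close_toPn : ~~ close_to (G j) (L j) m by apply: Cim; rewrite mem_iota lt_ij.
    by case/(_ _ Gjn); [constructor 2 | constructor 3].
  by constructor 2; have := greedy_ge (gap_gt0 _) Gjn; lia.
have eij : i = j by lia.
subst j; case: (ltngtP m n) => [lt_mn|lt_nm|->]; last by constructor 1.
- by constructor 2; have := greedy_gap (gap_gt0 i) Gim Gjn lt_mn; lia.
- by constructor 3; have := greedy_gap (gap_gt0 i) Gjn Gim lt_nm; lia.
Qed.

Let G_density i N : N <= K i * gap i * cnt (G i) N + (K i * gap i + c i).
Proof.
have := A_density i N; have := greedy_density (A i) (gap_gt0 i) N; rewrite -/(G i); nia.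
Qed.

(** The 8 in [gap_of] is spent here: one factor 2 for the two sides of [close_to], one for
    [N + L j <= 2 * N], one for the 2 in the claim. *)
Let close_small i j N : i < j ->
  2 * (K i * gap i) * cnt (close_to (G j) (L j)) N * 2 ^ j <= N.
Proof.
move=> /gap_sum_le; move: (K i * gap i) => k le_k.
have := cnt_close_to (G j) (L j) N.
have := greedy_sparse (A j) (gap_gt0 j) (N + L j); rewrite -/(G j).
move: (cnt (close_to _ _) _) (cnt (G j) _) => r b.
have [-> _|b_gt0 gb rb] := posnP b; first by rewrite muln0 leqn0 => /eqP ->; lia.
(* An element of [G j] below [N + L j] forces [gap j <= N + L j], and the gap contains the summand
   [2 * L j]. *)
have NL : L j <= N.
  by have : gap j <= N + L j by [nia]; rewrite /gap /gap_of; lia.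
have : 8 * (L j * 2 ^ j * gap_sum j) * b <= 2 * N.
  apply: leq_trans (_ : gap j * b <= _); last by lia.
  by rewrite leq_mul2r /gap /gap_of; apply/orP; right; lia.
have : k * r * 2 ^ j <= 2 * (L j * 2 ^ j * gap_sum j) * b.
  apply: (@leq_trans (gap_sum j * (2 * L j * b) * 2 ^ j)); last by lia.
  by rewrite leq_mul2r leq_mul// orbT.
lia.
Qed.

(** By the geometric sum, trimming costs at most half of the density known for [G i]; hence the
    doubled constants. *)
Lemma separated_subset_density i : has_pos_density (separated_subset i).
Proof.
exists (2 * (K i * gap i)), (2 * (K i * gap i + c i)) => N.
have split_G : cnt (G i) N <= cnt (separated_subset i) N +
    \sum_(i.+1 <= j < i.+1 + N) cnt (close_to (G j) (L j)) N.
  rewrite /cnt exchange_big -big_split /= big_seq [leqRHS]big_seq.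
  apply: leq_sum => n; rewrite mem_index_iota => /andP[_ nN].
  rewrite /separated_subset; case: (G i n) => //=.
  case: (boolP (all _ _)) => //= /allPn[j]; rewrite mem_iota negbK => jn hj.
  rewrite add0n (leq_trans _ (has_leq_sum _ _))//.
  suff -> : has (fun j => close_to (G j) (L j) n) (index_iota i.+1 (i.+1 + N)) by [].
  by apply/hasP; exists j => //; rewrite mem_index_iota; lia.
have := sum_le_geometric (i.+1 + N) (fun j => @close_small i j N).
rewrite -big_distrr /=.
move: (\sum_(_ <= _ < _) _) split_G (G_density i N) => r; nia.
Qed.

End SeparatedSubsets.

Lemma separated_subsets (A : nat -> pred nat) (L : nat -> nat) :
  (forall i, 0 < L i) -> (forall i, has_pos_density (A i)) ->
  exists B : nat -> pred nat,
  [/\ forall i n, B i n -> A i n /\ L i <= n,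
      forall i, has_pos_density (B i) &
      forall i j m n, i <= j -> B i m -> B j n ->
        [\/ i = j /\ m = n, m + L j <= n | n + L j <= m]].
Proof.
move=> L_gt0 /choice[K] /choice[c Hc].
exists (separated_subset A L K); split.
- exact: separated_subset_sub.
- by move=> i; apply: separated_subset_density.
- by move=> i j m n; apply: separated_subset_gap.
Qed.

Local Open Scope classical_set_scope.
Local Open Scope ring_scope.

(** * Positive lower density as a counting bound *)

Lemma limn_einf_gt0P (R : realType) (u : nat -> R) :
  (0 < limn_einf (fun n => (u n)%:E))%E <->
  exists2 r, 0 < r & exists N, forall n, (N <= n)%N -> r <= u n.
Proof.
rewrite limn_einf_lim (cvg_lim _ (@cvg_einfs_sup R _))//; split.
  case/ereal_sup_gt => _ [N _ <-].
  set e := einfs _ N => inf_gt0.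
  have eu n : (N <= n)%N -> (e <= (u n)%:E)%E.
    by move=> Nn; apply: ereal_inf_lbound; exists n.
  have e_fin : e \is a fin_num.
    by rewrite fin_numE gt_eqF ?(lt_trans _ inf_gt0) ?ltNy0//= lt_eqF// (le_lt_trans (eu N _)) ?ltry.
  exists (fine e); first by rewrite fine_gt0// inf_gt0 ltey_eq e_fin.
  by exists N => n /eu; rewrite -{1}(fineK e_fin) lee_fin.
move=> [r r_gt0 [N ru]]; apply: (@lt_le_trans _ _ r%:E); first by rewrite lte_fin.
apply: (@le_trans _ _ (einfs (fun n => (u n)%:E) N)).
  by apply: le_ereal_inf_tmp => _ [n /= Nn <-]; rewrite lee_fin ru.
by apply: ereal_sup_ubound; exists N.
Qed.

Lemma pos_lower_densityP (R : realType) (A : set nat) :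
  pos_lower_density R A <-> has_pos_density (fun n => n \in A).
Proof.
rewrite /pos_lower_density /lower_density limn_einf_gt0P.
pose f N := (\sum_(1 <= n < N.+1) (n \in A))%N.
have fE N : \sum_(1 <= n < N.+1) ((n \in A : bool)%:R : R) = (f N)%:R.
  by rewrite /f natr_sum.
(* [lower_density] counts on [[1, N]] and [cnt] on [[0, N)]; they differ only at 0 and [N]. *)
have f_cnt N : ((0%N \in A) + f N = cnt (fun n => n \in A) N + (N \in A))%N.
  by rewrite -cntS /cnt big_nat_recl// /f big_add1.
split=> [[r r_gt0 [N0 hr]]|[K [c hK]]].
  exists (Num.bound r^-1), (N0 + Num.bound r^-1)%N => N.
  have [lt_N|le_N] := ltnP N N0; first lia.
  suff : (N <= Num.bound r^-1 * f N)%N by have := f_cnt N; move: (f N); do 2 case: (_ \in A) => /=; nia.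
  have [->//|N_gt0] := posnP N.
  have := hr _ le_N; rewrite fE ler_pdivlMr ?ltr0n// => hf.
  rewrite -(ler_nat R) natrM.
  have hb : 1 <= (Num.bound r^-1)%:R * r.
    by rewrite -ler_pdivrMr// div1r ltW// archi_boundP// invr_ge0 ltW.
  apply: (@le_trans _ _ ((Num.bound r^-1)%:R * (r * N%:R))).
    by rewrite mulrA ler_peMl.
  by rewrite ler_wpM2l.
have K_gt0 : (0 < K)%N by have := hK c.+1; case: (K) => //; lia.
exists (2 * K)%:R^-1; first by rewrite invr_gt0 ltr0n; lia.
(* From here on [K + c] is below half of [N], which leaves the ratio [1 / (2 * K)]. *)
exists (2 * (K + c)).+1 => N le_N; rewrite fE.
have N_gt0 : (0 < N)%N by lia.
rewrite ler_pdivlMr ?ltr0n// ler_pdivrMl ?ltr0n ?muln_gt0// -natrM ler_nat.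
by have := f_cnt N; have := hK N; move: (f N); do 2 case: (_ \in A) => /=; nia.
Qed.

(** * Completeness of Polish abelian groups *)

Section TopologicalGroup.
Variable X : topologicalZmodType.
Implicit Types (u v : nat -> X) (W : set X).

(** Cauchy for the group structure, which may differ from Cauchy for the complete metric. *)
Definition group_cauchy u : Prop := forall W, nbhs 0 W ->
  exists N, forall p q, (N <= p)%N -> (p <= q)%N -> W (u q - u p).

Definition group_complete : Prop :=
  forall u, group_cauchy u -> exists l : X, u @ \oo --> l.

Lemma nbhs_half W : nbhs 0 W ->
  exists2 W', nbhs 0 W' & forall a b, W' a -> W' b -> W (a + b).
Proof.
move=> W0; have := @add_continuous X (0, 0) W; rewrite /= addr0 => /(_ W0).
case=> -[P Q] /= [P0 Q0] PQ; exists (P `&` Q); first exact: filterI.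
by move=> a b [Pa _] [_ Qb]; apply: (PQ (a, b)).
Qed.

Lemma nbhs_addl (x : X) W : nbhs x W -> nbhs 0 [set a | W (x + a)].
Proof.
move=> Wx; have := @add_continuous X (x, 0) W; rewrite /= addr0 => /(_ Wx).
case=> -[P Q] /= [Px Q0] PQ; apply: filterS Q0 => a Qa.
by apply: (PQ (x, a)); split=> //; exact: nbhs_singleton.
Qed.

Lemma nbhs_subr (x : X) W : nbhs 0 W -> nbhs x [set y | W (y - x)].
Proof.
move=> W0; have := @sub_continuous X (x, x) W; rewrite /= subrr => /(_ W0).
case=> -[P Q] /= [Px Qx] PQ; apply: filterS Px => a Pa.
by apply: (PQ (a, x)); split=> //; exact: nbhs_singleton.
Qed.

Lemma nbhs0_opp W : nbhs 0 W -> nbhs 0 [set y : X | W (- y)].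
Proof. by move=> W0; have := @opp_continuous X 0 W; rewrite oppr0; apply. Qed.

Lemma cvg_addition (u v : nat -> X) (a b : X) :
  u @ \oo --> a -> v @ \oo --> b -> (fun n => u n + v n) @ \oo --> a + b.
Proof.
move=> ua vb; apply: (@cvg_comp _ _ _ (fun n => (u n, v n)) (fun z => z.1 + z.2)).
  exact: (cvg_pair ua vb).
exact: (@add_continuous X (a, b)).
Qed.

Lemma cvg_group_cauchy u (l : X) : u @ \oo --> l -> group_cauchy u.
Proof.
move=> ul W W0.
have := @sub_continuous X (l, l) W; rewrite /= subrr => /(_ W0).
case=> -[P Q] /= [Pl Ql] PQ.
have [N _ hN] : \forall n \near \oo, P (u n) /\ Q (u n).
  by apply: filterI; apply: ul.
exists N => p q Np pq; apply: (PQ (u q, u p)); split.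
  by have [] := hN q (leq_trans Np pq).
by have [] := hN p Np.
Qed.

Lemma group_cauchy_cvg u (l : X) (n_ : nat -> nat) : group_cauchy u ->
  (forall k, (k <= n_ k)%N) -> (u \o n_) @ \oo --> l -> u @ \oo --> l.
Proof.
move=> cu n_ge ul W Wl.
have [W' W'0 hW'] := nbhs_half (nbhs_addl Wl).
have [N hN] := cu _ W'0.
have [M _ hM] := ul _ (nbhs_subr l W'0).

have [N' le_N' leM'] : exists2 k, (N <= k)%N & (M <= k)%N.
  by exists (maxn N M); rewrite ?leq_maxl ?leq_maxr.
exists (n_ N') => // m /= le_m.
have -> : u m = l + ((u (n_ N') - l) + (u m - u (n_ N'))).
  by rewrite addrA subrKC addrC subrK.
apply: hW'; first exact: hM.
by apply: hN => //; exact: leq_trans (n_ge _).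
Qed.

End TopologicalGroup.

Section Metric.
Variables (R : realType) (X : topologicalType) (d : X -> X -> R).
Hypothesis d_sep : forall x y, d x y = 0 <-> x = y.
Hypothesis d_sym : forall x y, d x y = d y x.
Hypothesis d_tri : forall x y z, d x z <= d x y + d y z.
Hypothesis d_open : forall A : set X, open A <->
  (forall x, A x -> exists2 e : R, 0 < e & [set y | d x y < e] `<=` A).

Lemma nbhs_metric_ball (x : X) (e : R) : 0 < e -> nbhs x [set y | d x y < e].
Proof.
move=> e0; apply: open_nbhs_nbhs; split=> /=; last by have /d_sep -> := erefl x.
apply/d_open => y /= xy; exists (e - d x y); first by rewrite subr_gt0.
by move=> z /= yz; apply: le_lt_trans (d_tri x y z) _; rewrite addrC -ltrBrDr.
Qed.

Lemma nbhs_metricP (x : X) (A : set X) :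
  nbhs x A -> exists2 e : R, 0 < e & [set y | d x y < e] `<=` A.
Proof.
rewrite nbhsE; case=> O [/d_open hO Ox] OA; have [e e0 he] := hO x Ox.
by exists e => // y /he /OA.
Qed.


Lemma metric_geometric_cauchy (v : nat -> X) :
  (forall k, d (v k) (v k.+1) < 2^-1 ^+ k) ->
  forall e : R, 0 < e -> exists N : nat,
    forall m n, (N <= m)%N -> (N <= n)%N -> d (v m) (v n) < e.
Proof.
move=> hv e e0.
have dvD m k : d (v m) (v (m + k)%N) <= 2 * 2^-1 ^+ m - 2 * 2^-1 ^+ (m + k).
  elim: k => [|k IH]; first by rewrite addn0 subrr (_ : d _ _ = 0)//; apply/d_sep.
  rewrite addnS; apply: le_trans (d_tri _ (v (m + k)%N) _) _.
  by have := hv (m + k)%N; rewrite exprS; lra.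
pose N := Num.bound (2 / e); exists N => m n.
wlog mn : m n / (m <= n)%N.
  by case: (leqP m n) => [|/ltnW] mn h Nm Nn; [|rewrite d_sym]; apply: h.
move=> Nm _; have := dvD m (n - m)%N; rewrite subnKC// => dmn.
have : 2 / e < 2 ^+ m by apply: upper_nthrootP.
rewrite ltr_pdivrMr// mulrC -ltr_pdivrMr ?exprn_gt0// -exprVn => hm.
by have : 0 <= 2^-1 ^+ n :> R by [exact: exprn_ge0]; lra.
Qed.

End Metric.

(* Klee's theorem.  If [p] satisfies [p j.+1 = u (n j) - p j], then both
   [p j.+2 - p j = u (n j.+1) - u (n j)] and [p j + p j.+1 = u (n j)]; choosing
   [n j] after [p j] makes the even and the odd terms of [p] Cauchy for the
   complete metric, even though it need not be translation invariant. *)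
Lemma polish_group_complete (R : realType) (X : topologicalZmodType) :
  polish R X -> group_complete X.
Proof.
case=> _ [d [d_sep d_sym d_tri d_open d_complete]] u cu.
(* Late differences of [u] move the given point [x] by less than [2 ^- k]. The index depends on [x],
   so [n j] must be chosen after [p j]. *)
have /choice[N hN] : forall xk : X * nat, exists N, (xk.2 <= N)%N /\
    forall p q, (N <= p)%N -> (p <= q)%N ->
      d xk.1 (xk.1 + (u q - u p)) < 2^-1 ^+ xk.2.
  case=> x k /=.
  have e_gt0 : 0 < 2^-1 ^+ k :> R by rewrite exprn_gt0// invr_gt0.
  have [N hN] := cu _ (nbhs_addl (nbhs_metric_ball d_sep d_tri d_open x e_gt0)).
  exists (maxn k N); split=> [|p q]; first exact: leq_maxl.
  by rewrite geq_max => /andP[_ Np] /(hN _ _ Np).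
pose st := fix st j : X * nat := if j is i.+1 then
  let: (p, n) := st i in (u n - p, maxn n (N (u n - p, i.+1))) else (0, N (0, 0%N)).
pose p j := (st j).1; pose n j := (st j).2.
have pS j : p j.+1 = u (n j) - p j by rewrite /p /n /=; case: (st j).
have nS j : (n j <= n j.+1)%N by rewrite /n /=; case: (st j) => a b; rewrite leq_maxl.
have nN j : (N (p j, j) <= n j)%N.
  by case: j => // j; rewrite /p /n /=; case: (st j) => a b; rewrite leq_maxr.
have n_ge j : (j <= n j)%N by apply: leq_trans (nN j); have [] := hN (p j, j).
have dp j : d (p j) (p j.+2) < 2^-1 ^+ j.
  have [_ /(_ _ _ (nN j) (nS j))] := hN (p j, j).
  by rewrite !pS /= opprB addrCA addrC -!addrA addrC.
have half k i : 2^-1 ^+ (i + k) <= 2^-1 ^+ k :> R.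
  by rewrite exprD ler_piMl ?exprn_ge0// exprn_ile1//; lra.
have [g pg] : exists l : X, p (2 * k)%N @[k --> \oo] --> l.
  apply/d_complete/(metric_geometric_cauchy d_sep d_sym d_tri) => k.
  rewrite mulnS; apply: lt_le_trans (dp _) _; rewrite mul2n -addnn; exact: half.
have [h ph] : exists l : X, p (2 * k).+1 @[k --> \oo] --> l.
  apply/d_complete/(metric_geometric_cauchy d_sep d_sym d_tri) => k.
  by rewrite mulnS; apply: lt_le_trans (dp _) _; rewrite mul2n -addnn -addSn; exact: half.
exists (g + h); apply: (group_cauchy_cvg (n_ := fun k => n (2 * k)%N) cu).
  by move=> k; apply: leq_trans (n_ge _); lia.
rewrite (_ : _ \o _ = fun k => p (2 * k)%N + p (2 * k).+1); first exact: cvg_addition.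
by apply/funext => k; rewrite pS /= addrC subrK.
Qed.

(** * Small finite subsums of unconditionally convergent series *)

(** The blocks [[a k, a k.+1)] partition the integers, and rearranging inside each of them is
    inverted block by block, by looking up positions in [L k]. *)
Lemma block_permutation (a : nat -> nat) (L : nat -> seq nat) :
  a 0%N = 0%N -> (forall k, a k < a k.+1)%N ->
  (forall k, perm_eq (L k) (iota (a k) (a k.+1 - a k))) ->
  exists2 sigma : nat -> nat, bijective sigma &
    forall k i, (i < size (L k))%N -> sigma (a k + i)%N = nth 0%N (L k) i.
Proof.
move=> a0 a_lt pL.
have a_le : {homo a : k l / (k <= l)%N}.
  by apply: homo_leq => // [|k]; [exact: leq_trans | exact: ltnW].
have /choice[blk hblk] n : exists k, (a k <= n < a k.+1)%N.
  elim: n => [|n [k /andP[kn nk]]]; first by exists 0%N; rewrite a0 -[X in (X < _)%N]a0 a_lt.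
  have [lt_n|ge_n] := ltnP n.+1 (a k.+1); first by exists k; lia.
  by exists k.+1; have := a_lt k.+1; lia.
have blk_uniq n k : (a k <= n < a k.+1)%N -> blk n = k.
  have := hblk n; case: (ltngtP (blk n) k) => // [/a_le|/a_le]; lia.
have sizeL k : size (L k) = (a k.+1 - a k)%N by rewrite (perm_size (pL k)) size_iota.
have memL k n : (n \in L k) = (a k <= n < a k.+1)%N.
  by rewrite (perm_mem (pL k)) mem_iota subnKC// ltnW.
pose sigma n := nth 0%N (L (blk n)) (n - a (blk n)).
pose tau n := (a (blk n) + index n (L (blk n)))%N.
have blk_sigma n : blk (sigma n) = blk n.
  apply: blk_uniq; rewrite -memL mem_nth// sizeL; have := hblk n; lia.
have n_mem n : n \in L (blk n) by rewrite memL hblk.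
have blk_tau n : blk (tau n) = blk n.
  apply: blk_uniq; have := n_mem n; rewrite -index_mem sizeL /tau.
  by have := a_lt (blk n); lia.
exists sigma.
  exists tau => n.
    rewrite {1}/tau blk_sigma /sigma index_uniq ?(perm_uniq (pL _)) ?iota_uniq//.
      by have := hblk n; lia.
    by rewrite sizeL; have := hblk n; lia.
  by rewrite {1}/sigma blk_tau /tau addKn nth_index.
move=> k i; rewrite sizeL => lt_i; rewrite /sigma (@blk_uniq _ k) ?addKn//; lia.
Qed.

(** Otherwise there are bad finite sets arbitrarily far out. A permutation making infinitely many of
    them contiguous turns their sums into differences of partial sums of a convergent series,
    against the Cauchy property. *)
Lemma uncond_cvg_sum_small (K : numDomainType) (X : topologicalLmodType K)
    (u : nat -> X) (W : set X) : uncond_cvg u -> nbhs 0 W ->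
  exists N, forall s : seq nat, uniq s -> all (leq N) s -> W (\sum_(n <- s) u n).
Proof.
move=> hu W0; apply: contrapT => noN.
have /choice[F hF] N : exists s : seq nat,
    [/\ uniq s, all (leq N) s & ~ W (\sum_(n <- s) u n)].
  apply: contrapT => noF; apply: noN; exists N => s us Ns.
  by apply: contrapT => nW; apply: noF; exists s.
(* The next block starts beyond the whole bad set [F N]. *)
pose next N := (maxn N (\max_(n <- F N) n)).+1.
have ltF N n : n \in F N -> (N <= n < next N)%N.
  have [_ /allP hN _] := hF N => nF; rewrite hN//= ltnS leq_max.
  by rewrite ((leq_bigmax_seq (F := fun n => n)))// orbT.
pose a k := iter k next 0%N.
pose L k := F (a k) ++ [seq n <- iota (a k) (a k.+1 - a k) | n \notin F (a k)].
have a_lt k : (a k < a k.+1)%N by rewrite ltnS leq_maxl.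
have pL k : perm_eq (L k) (iota (a k) (a k.+1 - a k)).
  have [uF _ _] := hF (a k); apply: uniq_perm; last 1 first.
  - move=> n; rewrite mem_cat mem_filter mem_iota (subnKC (ltnW (a_lt k))).
    by case: (boolP (n \in F (a k))) => [/ltF ->|//].
  - rewrite cat_uniq uF filter_uniq ?iota_uniq// andbT /=.
    by apply/hasPn => n; rewrite mem_filter => /andP[].
  - exact: iota_uniq.
have [sigma bij_sigma hsigma] := block_permutation (erefl : a 0%N = 0%N) a_lt pL.
have [l /cvg_group_cauchy/(_ W W0)[N hN]] := hu sigma bij_sigma.
have N_a : (N <= a N)%N by elim: (N) => // k IH; apply: leq_ltn_trans IH (a_lt k).
have [_ _] := hF (a N); apply.
have := hN (a N) (a N + size (F (a N)))%N N_a (leq_addr _ _).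
rewrite sub_series_geq ?leq_addr// -{1}[a N]add0n big_addn addKn.
rewrite [X in _ -> W X](big_nth 0%N); congr (W _); rewrite !big_nat; apply: eq_bigr => i.
by move=> /andP[_ iF]; rewrite addnC hsigma ?size_cat ?ltn_addr// /L nth_cat iF.
Qed.

(** * The frequently returning vector *)

Lemma polish_nbhs_base (R : realType) (X : topologicalType) (x : X) : polish R X ->
  exists U : nat -> set X, (forall k, nbhs x (U k)) /\
    forall W, nbhs x W -> exists k, U k `<=` W.
Proof.
case=> _ [d [d_sep _ d_tri d_open _]].
exists (fun k => [set y | d x y < 2^-1 ^+ k]); split=> [k|W].
  by apply: nbhs_metric_ball => //; rewrite exprn_gt0// invr_gt0.
move=> /(nbhs_metricP d_open)[e e0 he].
exists (Num.bound e^-1) => y xy; apply: he => /=; apply: lt_trans xy _.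
by rewrite exprVn invf_plt ?posrE ?exprn_gt0// upper_nthrootP.
Qed.

Section NbhsChain.
Variable X : topologicalZmodType.

(** The [W k] act as balls of radius [2 ^- k] in the absence of an invariant metric. *)
Lemma nbhs_chain (Q : nat -> set X) : (forall k, nbhs 0 (Q k)) ->
  exists W : nat -> set X, [/\ forall k, nbhs 0 (W k), forall k, W k `<=` Q k &
    forall k a b, W k.+1 a -> W k.+1 b -> W k (a + b)].
Proof.
move=> Q0.
have /choice[half hhalf] (V : set X) : exists V' : set X, nbhs 0 V ->
    nbhs 0 V' /\ forall a b, V' a -> V' b -> V (a + b).
  have [/nbhs_half[V' ? ?]|nV] := pselect (nbhs 0 V); first by exists V'.
  by exists V.
pose W := fix W k := if k is k'.+1 then half (W k') `&` Q k else Q 0%N.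
have W0 k : nbhs 0 (W k).
  elim: k => [|k IH] /=; first exact: Q0.
  by apply: filterI => //; have [] := hhalf _ IH.
exists W; split=> // [[|k] //= a []//|k a b /= [Wa _] [Wb _]].
by have [_] := hhalf _ (W0 k); apply.
Qed.

Variable W : nat -> set X.
Hypothesis W0 : forall k, W k 0.
Hypothesis WD : forall k a b, W k.+1 a -> W k.+1 b -> W k (a + b).

Lemma chain_decreasing k l : (k <= l)%N -> W l `<=` W k.
Proof.
move=> /subnKC <-; elim: (l - k)%N => [|n IH]; first by rewrite addn0.
by rewrite addnS => a /= Wa; apply: IH; rewrite -(addr0 a); exact: WD.
Qed.

(** The analogue of bounding the sum of the [2 ^- (c + j + 1)] by [2 ^- c]. *)
Lemma chain_sum (t : nat -> X) (c J : nat) :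
  (forall j, (j < J)%N -> W (c + j.+1) (t j)) -> W c (\sum_(0 <= j < J) t j).
Proof.
elim: J c t => [|J IH] c t ht; first by rewrite big_geq.
rewrite big_nat_recl//; apply: WD; first by have := ht 0%N; rewrite addn1; apply.
by apply: IH => j jJ; have := ht j.+1; rewrite addnS addSn; apply.
Qed.

End NbhsChain.

Lemma iter_linear_sum (K : numDomainType) (X : lmodType K) (T : {linear X -> X})
    (m : nat) (J : Type) (r : seq J) (P : pred J) (f : J -> X) :
  iter m T (\sum_(j <- r | P j) f j) = \sum_(j <- r | P j) iter m T (f j).
Proof. by elim: m => //= m ->; rewrite linear_sum. Qed.

Lemma continuous_iter (X : topologicalType) (T : X -> X) (m : nat) :
  continuous T -> continuous (iter m T).
Proof.
move=> cT; elim: m => [|m IH] x /=; first exact: cvg_id.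
exact: continuous_comp (IH x) (cT _).
Qed.

Section RightInverseOn.
Variables (X : Type) (D : set X) (T S : X -> X).
Hypothesis SD : forall x, D x -> D (S x).
Hypothesis TS : forall x, D x -> T (S x) = x.

Lemma iter_right_inverse x n : D x -> iter n T (iter n S x) = x.
Proof.
move=> Dx; elim: n => // n IH; rewrite iterSr iterS TS//.
by elim: {IH} n => //= n; exact: SD.
Qed.

Lemma iter_right_inverse_geq x m n : D x -> (n <= m)%N ->
  iter m T (iter n S x) = iter (m - n) T x.
Proof. by move=> Dx nm; rewrite -{1}(subnK nm) iterD iter_right_inverse. Qed.

Lemma iter_right_inverse_leq x m n : D x -> (m <= n)%N ->
  iter m T (iter n S x) = iter (n - m) S x.
Proof.
move=> Dx mn; rewrite -{1}(subnKC mn) iterD iter_right_inverse//.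
by elim: (n - m)%N => //= k; exact: SD.
Qed.

End RightInverseOn.

Section FrequentlyReturningVector.
Variables (K : numDomainType) (X : topologicalLmodType K) (T : {linear X -> X}).
Variables (S : X -> X) (x_ : nat -> X) (W : nat -> set X) (L : nat -> nat).
Variable B : nat -> pred nat.
Hypothesis X_complete : group_complete X.
Hypothesis T_continuous : continuous T.
Hypothesis W_nbhs : forall k, nbhs 0 (W k).
Hypothesis WD : forall k a b, W k.+1 a -> W k.+1 b -> W k (a + b).
Hypothesis W_base : forall V, nbhs 0 V -> exists k, W k `<=` V.
Hypothesis TS_geq : forall j m n, (n <= m)%N ->
  iter m T (iter n S (x_ j)) = iter (m - n) T (x_ j).
Hypothesis TS_leq : forall j m n, (m <= n)%N ->
  iter m T (iter n S (x_ j)) = iter (n - m) S (x_ j).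
Hypothesis L_gt : forall k, (k < L k)%N.
Hypothesis T_small : forall j k (s : seq nat), (j <= k)%N -> uniq s ->
  all (leq (L k)) s -> W (2 * k + 3) (\sum_(n <- s) iter n T (x_ j)).
Hypothesis S_small : forall j k (s : seq nat), (j <= k)%N -> uniq s ->
  all (leq (L k)) s -> W (2 * k + 3) (\sum_(n <- s) iter n S (x_ j)).
Hypothesis B_ge : forall i n, B i n -> (L i <= n)%N.
Hypothesis B_gap : forall i j m n, (i <= j)%N -> B i m -> B j n ->
  [\/ i = j /\ m = n, (m + L j <= n)%N | (n + L j <= m)%N].

Let W_anti k l : (k <= l)%N -> W l `<=` W k.
Proof. by apply: chain_decreasing => // n; exact: nbhs_singleton. Qed.

Let W_sum (t : nat -> X) (c J : nat) :
  (forall j, (j < J)%N -> W (c + j.+1) (t j)) -> W c (\sum_(0 <= j < J) t j).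
Proof. by apply: chain_sum => // n; exact: nbhs_singleton. Qed.

(** The level [i + j + 3] leaves room for three losses: adding the [T] and [S] parts, summing over
    [j], and passing to the limit, ending in [W i]. *)
Let T_small_max i j s : uniq s -> all (leq (L (maxn i j))) s ->
  W (i + j + 3) (\sum_(n <- s) iter n T (x_ j)).
Proof.
move=> us hs; apply: (W_anti (l := 2 * maxn i j + 3)); first by lia.
by apply: T_small => //; exact: leq_maxr.
Qed.

Let S_small_max i j s : uniq s -> all (leq (L (maxn i j))) s ->
  W (i + j + 3) (\sum_(n <- s) iter n S (x_ j)).
Proof.
move=> us hs; apply: (W_anti (l := 2 * maxn i j + 3)); first by lia.
by apply: S_small => //; exact: leq_maxr.
Qed.

Let B_gap_max i j m n : B i m -> B j n ->
  [\/ i = j /\ m = n, (m + L (maxn i j) <= n)%N | (n + L (maxn i j) <= m)%N].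
Proof.
move=> Bm Bn; case: (leqP i j) => [ij|/ltnW ji]; first exact: B_gap.
by case: (B_gap ji Bn Bm) => [[-> ->]||]; [constructor 1|constructor 3|constructor 2].
Qed.

Let partial M := \sum_(0 <= j < M) \sum_(0 <= n < M | B j n) iter n S (x_ j).

(** Rows [j >= M] are empty, since elements of [B j] are at least [L j > j]. *)
Let partialE M J : (M <= J)%N ->
  partial M = \sum_(0 <= j < J) \sum_(0 <= n < M | B j n) iter n S (x_ j).
Proof.
move=> MJ; rewrite (big_cat_nat (leq0n M) MJ)/= [X in _ + X]big1_seq ?addr0//.
move=> j; rewrite mem_index_iota => /andP[_ /andP[Mj _]].
rewrite big_nat_cond big_pred0// => n; apply/negP => /andP[nM /B_ge].
by have := L_gt j; lia.
Qed.

(** In row [j] the new exponents are at least both [L k] and [L j], so the row is small at level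
    [k + j + 3] and the rows add up in [W k]. *)
Let partial_cauchy : group_cauchy partial.
Proof.
move=> V /W_base[k WV]; exists (L k) => p q kp pq; apply: WV.
rewrite (partialE (leqnn q)) (partialE pq) -sumrB; apply: W_sum => j _.
rewrite (big_cat_nat (leq0n p) pq)/= addrAC subrr add0r -big_filter.
apply: (W_anti (l := k + j + 3)); first by lia.
apply: S_small_max; first by rewrite filter_uniq ?iota_uniq.
apply/allP => n; rewrite mem_filter mem_index_iota => /andP[/B_ge jn /andP[pn _]].
by rewrite /maxn; case: ifP => _ //; exact: leq_trans pn.
Qed.

(** Splitting at [n = m] leaves powers of [T] below and of [S] above; by separation all exponents
    are at least [L (maxn i j)]. *)
Let orbit_small i m j M : B i m -> (m < M)%N ->
  W (i + j + 2) (\sum_(0 <= n < M | B j n) iter m T (iter n S (x_ j))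
                 - (if B j m then x_ j else 0)).
Proof.
move=> Bm mM.
rewrite (big_cat_nat (leq0n m) (ltnW mM))/=.
rewrite [X in _ + X - _](_ : _ = (if B j m then iter m T (iter m S (x_ j)) else 0) +
    \sum_(m.+1 <= n < M | B j n) iter m T (iter n S (x_ j))); last first.
  by rewrite big_mkcond big_ltn// -big_mkcond.
have -> : (if B j m then iter m T (iter m S (x_ j)) else 0) = if B j m then x_ j else 0.
  by rewrite TS_geq// subnn.
rewrite addrCA addrAC subrr add0r; apply: WD; rewrite -addnS.
- rewrite [X in W _ X](_ : _ =
      \sum_(k <- [seq (m - n)%N | n <- index_iota 0 m & B j n]) iter k T (x_ j)); last first.
    rewrite big_map big_filter [LHS]big_nat_cond [RHS]big_nat_cond.
    by apply: eq_bigr => n /andP[/andP[_ /ltnW nm] _]; exact: TS_geq.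
  apply: T_small_max.
    rewrite map_inj_in_uniq ?filter_uniq ?iota_uniq// => a b.
    by rewrite !mem_filter !mem_index_iota; lia.
  rewrite all_map; apply/allP => n; rewrite mem_filter mem_index_iota => /andP[Bn /andP[_ nm]] /=.
  by case: (B_gap_max Bm Bn); lia.
- rewrite [X in W _ X](_ : _ =
      \sum_(k <- [seq (n - m)%N | n <- index_iota m.+1 M & B j n]) iter k S (x_ j)); last first.
    rewrite big_map big_filter [LHS]big_nat_cond [RHS]big_nat_cond.
    by apply: eq_bigr => n /andP[/andP[/ltnW mn _] _]; exact: TS_leq.
  apply: S_small_max.
    rewrite map_inj_in_uniq ?filter_uniq ?iota_uniq// => a b.
    by rewrite !mem_filter !mem_index_iota; lia.
  rewrite all_map; apply/allP => n; rewrite mem_filter mem_index_iota => /andP[Bn /andP[mn _]] /=.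
  by case: (B_gap_max Bm Bn); lia.
Qed.

Let orbit_partial i m M : B i m -> (m < M)%N -> W i.+1 (iter m T (partial M) - x_ i).
Proof.
move=> Bm mM; have L_le := B_ge Bm; have L_gt_i := L_gt i.
(* Separation makes the [B j] disjoint, so only [j = i] contributes; [i < L i <= m < M] puts it in
   range. *)
have -> : x_ i = \sum_(0 <= j < M) if B j m then x_ j else 0.
  rewrite (big_rem i) /=; last by rewrite mem_index_iota; lia.
  rewrite Bm big1_seq ?addr0// => j /=; rewrite mem_rem_uniq ?iota_uniq// inE => /andP[ji _].
  case: ifP => // Bjm; have := L_gt (maxn i j).
  by case: (B_gap_max Bm Bjm) => [[ij _]|?|?]; [rewrite ij eqxx in ji|lia|lia].
rewrite /partial iter_linear_sum -sumrB; apply: W_sum => j _.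
rewrite iter_linear_sum; apply: (W_anti (l := i + j + 2)); first by lia.
exact: orbit_small.
Qed.

Lemma frequently_returning_vector :
  exists x, forall i m, B i m -> W i (iter m T x - x_ i).
Proof.
have [x px] := X_complete partial_cauchy; exists x => i m Bm.
have Tpx : (fun M => iter m T (partial M)) @ \oo --> iter m T x.
  have cT : continuous (iter m T) by exact: continuous_iter.
  exact: (continuous_cvg _ (cT x) px).
(* The [W k] need not be closed: the limit is reached by adding a second error in [W i.+1]. *)
have near_Tx : nbhs (iter m T x) [set y | W i.+1 (iter m T x - y)].
  apply: filterS (nbhs_subr (iter m T x) (nbhs0_opp (W_nbhs i.+1))) => y /=.
  by rewrite opprB.
have [N _ hN] := Tpx _ near_Tx.
pose M := maxn N m.+1.
have -> : iter m T x - x_ i =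
    (iter m T (partial M) - x_ i) + (iter m T x - iter m T (partial M)).
  by rewrite [RHS]addrC [RHS]addrA subrK.
apply: WD; first by apply: orbit_partial => //; rewrite leq_maxr.
by apply: hN; rewrite /= leq_maxl.
Qed.

End FrequentlyReturningVector.

(** * From the criterion to hereditary frequent hypercyclicity *)

Lemma FHC_frequent_returns (R : realType) (K : numDomainType)
    (X : topologicalLmodType K) (T : {linear X -> X})
    (V : nat -> set X) (A : nat -> pred nat) :
  polish R X -> continuous T -> FHC T ->
  (forall k, open (V k) /\ V k !=set0) -> (forall k, has_pos_density (A k)) ->
  exists (x : X) (B : nat -> pred nat), forall k, has_pos_density (B k) /\
    forall n, B k n -> A k n /\ V k (iter n T x).
Proof.
move=> polishX cT [D [D_dense [S [SD TS D_uncond]]]] V_open A_density.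
have /choice[x_ hx] k : exists x, V k x /\ D x.
  by have [oV nV] := V_open k; have [x []] := D_dense _ nV oV; exists x.
have [U [U_nbhs U_base]] := polish_nbhs_base 0 polishX.
(* [U k] makes the chain a base at 0; the other set turns an error in [W k] around [x_ k] into
   membership in [V k]. *)
have [W [W_nbhs WQ WD]] : exists W : nat -> set X, [/\ forall k, nbhs 0 (W k),
    forall k, W k `<=` U k `&` [set a | V k (x_ k + a)] &
    forall k a b, W k.+1 a -> W k.+1 b -> W k (a + b)].
  apply: nbhs_chain => k; apply: filterI => //; apply: nbhs_addl.
  by apply: open_nbhs_nbhs; split; [have [] := V_open k | have [] := hx k].
have /choice[N hN] (kj : nat * nat) : exists N, forall s : seq nat, uniq s -> all (leq N) s ->
    W (2 * kj.1 + 3)%N (\sum_(n <- s) iter n T (x_ kj.2)) /\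
    W (2 * kj.1 + 3)%N (\sum_(n <- s) iter n S (x_ kj.2)).
  case: kj => k j /=; have [_ Dx] := hx j; have [uT uS] := D_uncond _ Dx.
  have [NT hT] := uncond_cvg_sum_small uT (W_nbhs (2 * k + 3)%N).
  have [NS hS] := uncond_cvg_sum_small uS (W_nbhs (2 * k + 3)%N).
  exists (maxn NT NS) => s us hs; split; [apply: hT | apply: hS] => //.
    by apply: sub_all hs => n; rewrite geq_max => /andP[].
  by apply: sub_all hs => n; rewrite geq_max => /andP[].
(* One threshold for the finitely many [x_ j] with [j <= k]; adding [k] and a successor gives
   [k < L k]. *)
pose L k := (k + \max_(j < k.+1) N (k, nat_of_ord j)).+1.
have L_N k j : (j <= k)%N -> (N (k, j) <= L k)%N.
  rewrite -ltnS => jk; apply: leq_trans (leqW (leq_addl _ _)).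
  exact: (leq_bigmax (F := fun j : 'I_k.+1 => N (k, nat_of_ord j)) (Ordinal jk)).
have small k j (s : seq nat) : (j <= k)%N -> uniq s -> all (leq (L k)) s ->
    W (2 * k + 3)%N (\sum_(n <- s) iter n T (x_ j)) /\
    W (2 * k + 3)%N (\sum_(n <- s) iter n S (x_ j)).
  move=> jk us hs; apply: (hN (k, j)) => //.
  by apply: sub_all hs => n; apply: leq_trans; exact: L_N.
have [B [BA B_density B_gap]] := @separated_subsets A L (fun k => ltn0Sn _) A_density.
have [x xW] : exists x, forall i m, B i m -> W i (iter m T x - x_ i).
  apply: (@frequently_returning_vector _ _ T S x_ W L B) => //.
  - exact: polish_group_complete polishX.
  - move=> Z /U_base[k UZ]; exists k => a /WQ[Ua _]; exact: UZ.
  - by move=> j m n; apply: (iter_right_inverse_geq SD TS); have [] := hx j.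
  - by move=> j m n; apply: (iter_right_inverse_leq SD TS); have [] := hx j.
  - by move=> k; rewrite ltnS leq_addr.
  - by move=> j k s jk us hs; have [] := small k j s jk us hs.
  - by move=> j k s jk us hs; have [] := small k j s jk us hs.
  - by move=> i n /BA[].
exists x, B => k; split=> // n Bn; split; first by have [] := BA _ _ Bn.
by have /WQ[_ /=] := xW _ _ Bn; rewrite addrC subrK.
Qed.

Lemma FHC_HFHC (R : realType) (K : numDomainType) : FHC_implies_HFHC R K.
Proof.
move=> X T polishX _ cT fhcT I V A /countable_injP[f f_inj] V_open A_density.
have [i0|noI] := pselect (exists i : I, True); last first.
  by exists 0 => i; case: noI; exists i.
(* Reindexing by the integers: [g] is a left inverse of [f] and takes arbitrary values off its
   image, where repeated sets are harmless. *)
have /choice[g gE] (k : nat) : exists i, forall j, f j = k -> i = j.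
  have [[i fi]|no] := pselect (exists i, f i = k).
    by exists i => j fj; apply: f_inj; rewrite ?in_setT// fi fj.
  by have [i _] := i0; exists i => j fj; case: no; exists j.
have gf i : g (f i) = i by exact: gE.
have [x [B hB]] := FHC_frequent_returns polishX cT fhcT (fun k => V_open (g k))
  (fun k => proj1 (pos_lower_densityP R (A (g k))) (A_density (g k))).
exists x => i; apply/pos_lower_densityP.
have [] := hB (f i); rewrite gf => [[K' [c hc]]] BV; exists K', c => N.
apply: leq_trans (hc N) _; rewrite leq_add2r leq_mul2l; apply/orP; right.
apply: leq_sum => n _; case: (boolP (B _ n)) => // /BV[/set_mem An Vn].
by rewrite (_ : n \in _)// inE; split.
Qed.

(* Real scalars (R^o) and complex scalars (R[i]). *)
Theorem theorem2p1 (R : realType) :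
  FHC_implies_HFHC R R^o /\ FHC_implies_HFHC R (complex R).
Proof. by split; exact: FHC_HFHC. Qed.
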